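(* Let $K$ be an imaginary quadratic field, $p$ a prime, and $a,b,c\ge0$ integers. Then $r_K(p^a,p^b,p^c)$ equals the number of non-backtracking walks of length $c$ in the graph $G_p$ that start at a fixed vertex of level $a$ and end at a vertex of level $b$.
   Context: $r_K(A,B,N)$ is the number of cyclic subgroups $C$ of order $N$ of a fixed elliptic curve $E$ with CM by $K$ of conductor $A$ such that $E/C$ has conductor $B$ (the conductor of $\mathbb{C}/\mathfrak{a}$ being the $m$ with $\{\alpha\in K:\alpha\mathfrak{a}\subset\mathfrak{a}\}=\mathbb{Z}+m\mathcal{O}_K$). Let $\chi_K(p)\in\{-1,0,1\}$ according as $p$ is inert, ramified, or split in $K$. The graph $G_p$ (the volcano) has vertex set partitioned into levels $G_{p,k}$, $k\ge0$, and is the unique graph such that: $G_p$ is $(p+1)$-regular with no self-loops or multiple edges; the subgraph on level $0$ (the rim) is the complete graph on $2+\chi_K(p)$ vertices; for $k\ge1$ each vertex of level $k$ has a unique neighbor of level $k-1$, and these account for all edges not in the rim. A walk of length $c$ is a sequence $v_0,e_1,v_1,\dots,e_c,v_c$ with $e_i$ an edge joining $v_{i-1}$ and $v_i$; it is non-backtracking if $e_i\neq e_{i+1}$ for all $i$. *)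

(* Defs.v *)
From mathcomp Require Import all_boot all_order all_algebra.
Set Implicit Arguments. Unset Strict Implicit. Unset Printing Implicit Defensive.
Import Order.TTheory GRing.Theory Num.Theory.
Local Open Scope ring_scope.

(** * The imaginary quadratic field K = Q(sqrt(-d)), d >= 1 squarefree. *)

Definition squarefree (d : nat) : Prop :=
  forall q : nat, (1 < q)%N -> ~~ (q * q %| d)%N.

(* O_K = Z[w] with w^2 = tw w - nw:
   w = (1 + sqrt(-d))/2 if -d = 1 mod 4 (i.e. d = 3 mod 4), else w = sqrt(-d). *)
Definition tw (d : nat) : nat := if (d %% 4 == 3)%N then 1%N else 0%N.
Definition nw (d : nat) : nat := if (d %% 4 == 3)%N then ((d + 1) %/ 4)%N else d.

(* an element x + y w of K is represented by the pair (x, y) of rationals *)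
Definition K := (rat * rat)%type.

Definition kadd (u v : K) : K := (u.1 + v.1, u.2 + v.2).
Definition kzscale (k : int) (u : K) : K := (k%:~R * u.1, k%:~R * u.2).
Definition kmul (d : nat) (u v : K) : K :=
  (u.1 * v.1 - (nw d)%:R * (u.2 * v.2),
   u.1 * v.2 + u.2 * v.1 + (tw d)%:R * (u.2 * v.2)).

Definition in_OK (u : K) : Prop := exists b c : int, u = (b%:~R, c%:~R).

(** * Lattices in K (every CM elliptic curve by K is C/L for such an L) *)
Definition is_lattice (L : K -> Prop) : Prop :=
  exists e1 e2 : K, e1.1 * e2.2 - e1.2 * e2.1 != 0 /\
    forall z, L z <-> exists m1 m2 : int, z = kadd (kzscale m1 e1) (kzscale m2 e2).

Definition has_conductor (d : nat) (L : K -> Prop) (m : nat) : Prop :=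
  (0 < m)%N /\
  forall alpha : K,
    (forall z, L z -> L (kmul d alpha z)) <->
    (exists (a : int) (beta : K), in_OK beta /\
        alpha = kadd (a%:~R, 0) (kzscale (Posz m) beta)).

Definition ncard (T : Type) (P : T -> Prop) (n : nat) : Prop :=
  exists f : 'I_n -> T, injective f /\ (forall i, P (f i)) /\
    (forall x, P x -> exists i, f i = x).

(* C/L' is the quotient of C/Lam by a cyclic subgroup of order N :
   L' = Lam + Z g with g of exact order N modulo Lam. *)
Definition cyclic_quotient (Lam L' : K -> Prop) (N : nat) : Prop :=
  exists g : K,
    (forall z, L' z <-> exists (k : int) (w : K), Lam w /\ z = kadd w (kzscale k g)) /\
    (forall k : int, Lam (kzscale k g) <-> (Posz N %| k)%Z).

(* r_K(A,B,N) = r, for the fixed curve C/Lam of conductor A *)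
Definition rK_is (d : nat) (Lam : K -> Prop) (N B r : nat) : Prop :=
  ncard (fun L' : K -> Prop => cyclic_quotient Lam L' N /\ has_conductor d L' B) r.

(** * chi_K(p) via Dedekind-Kummer: number of roots of X^2 - tw X + nw mod p, minus 1 *)
Definition nroots (d p : nat) : nat :=
  #|[pred x : 'I_p | ((x * x + nw d) %% p == (tw d * x) %% p)%N]|.
Definition chiK (d p : nat) : int := (nroots d p)%:Z - 1.

Definition is_volcano (d p : nat) (V : Type) (adj : V -> V -> Prop)
    (level : V -> nat) : Prop :=
  (forall u v, adj u v -> adj v u) /\
  (forall v, ~ adj v v) /\
  (forall v, ncard (adj v) p.+1) /\
  ncard (fun v => level v = 0%N) (absz (2 + chiK d p)) /\
  (forall u v, level u = 0%N -> level v = 0%N -> u <> v -> adj u v) /\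
  (forall v, (0 < level v)%N ->
     ncard (fun u => adj v u /\ level u = (level v).-1) 1) /\
  (forall u v, adj u v ->
     (level u = 0%N /\ level v = 0%N) \/ level u = (level v).+1 \/ level v = (level u).+1).

(* non-backtracking walk of length c starting at v0 (as its vertex sequence;
   in a simple graph e_i = e_(i+1) iff v_(i-1) = v_(i+1)) *)
Definition nb_walk (V : Type) (adj : V -> V -> Prop) (v0 : V) (c : nat)
    (s : seq V) : Prop :=
  size s = c.+1 /\ head v0 s = v0 /\
  (forall i, (i.+1 < size s)%N -> adj (nth v0 s i) (nth v0 s i.+1)) /\
  (forall i, (i.+2 < size s)%N -> nth v0 s i <> nth v0 s i.+2).

(* Main.v *)
(* Superlattices of index p of a lattice L play the role of the neighbours of a vertex.
   Chains L_0 < L_1 < ... < L_c of such steps with L_(i+2) <> p^-1 L_i are exactly the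
   chains L_i = L_0 + Z p^(c-i) g with g of order p^c modulo L_0, so they correspond to the
   cyclic quotients of order p^c; the condition is non-backtracking, L and p^-1 L having
   the same conductor.  The number of such chains, as the number of non-backtracking walks
   in the volcano, is computed by a recursion that only involves how many neighbours of
   each level a vertex of a given level has.

   For the lattices, let L have conductor m = p^j and let M be the integral matrix of
   multiplication by m w on L; it is not scalar modulo any prime.  The superlattices of
   index p are indexed by the lines of L / p L, and the conductor goes up to p m unless the
   line is an eigenline of M mod p, in which case it goes down to m / p (or stays 1 if
   m = 1).  As M mod p is not scalar, its eigenlines correspond to the roots of its
   characteristic polynomial X^2 - m t X + m^2 n mod p, where w^2 = t w - n: there are
   1 + chi_K(p) of them if j = 0, and one if j > 0. *)
Require Import Defs.
From mathcomp Require Import all_boot all_order all_algebra.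
From mathcomp Require Import boolp zify ring lra.
Set Implicit Arguments. Unset Strict Implicit. Unset Printing Implicit Defensive.
Import Order.TTheory GRing.Theory Num.Theory.

(** * Finite cardinals *)

Lemma ncard_ext (T : Type) (P Q : T -> Prop) n :
  (forall x, P x <-> Q x) -> ncard P n -> ncard Q n.
Proof.
move=> PQ [f [finj [fP Pf]]]; exists f; split=> //; split=> [i|x /PQ]; last exact: Pf.
exact/PQ.
Qed.

(** Bridge to cardinals of finite sets: [P] is enumerated injectively from a subset of a finite
    type. *)
Lemma ncard_set (T : Type) (I : finType) (A : {set I}) (h : I -> T) (P : T -> Prop) :
  {in A &, injective h} -> (forall x, P x <-> exists2 i, i \in A & h i = x) ->
  ncard P #|A|.
Proof.
move=> hinj hP; exists (fun i => h (enum_val i)); split; last split.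
- by move=> i j /hinj E; apply: enum_val_inj; apply: E; exact: enum_valP.
- by move=> i; apply/hP; exists (enum_val i) => //; exact: enum_valP.
- by move=> x /hP[i iA <-]; exists (enum_rank_in iA i); rewrite enum_rankK_in.
Qed.

Lemma ncard_leq (T : Type) (P Q : T -> Prop) m n :
  (forall x, P x -> Q x) -> ncard P m -> ncard Q n -> (m <= n)%N.
Proof.
move=> PQ [f [finj [fP _]]] [g [_ [_ Qg]]].
have /fin_all_exists[s sE] : forall i, exists j, g j = f i by move=> i; exact/Qg/PQ/fP.
have /leq_card : injective s by move=> i j E; apply: finj; rewrite -!sE E.
by rewrite !card_ord.
Qed.

Lemma ncard_inj (T : Type) (P : T -> Prop) m n : ncard P m -> ncard P n -> m = n.
Proof.
by move=> Pm Pn; apply/eqP; rewrite eqn_leq (ncard_leq _ Pm Pn) // (ncard_leq _ Pn Pm).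
Qed.

Lemma ncard_map (T U : Type) (h : T -> U) (P : T -> Prop) (Q : U -> Prop) n :
  (forall x y, P x -> P y -> h x = h y -> x = y) ->
  (forall y, Q y <-> exists2 x, P x & h x = y) ->
  ncard P n -> ncard Q n.
Proof.
move=> hinj hQ [f [finj [fP Pf]]].
rewrite -[n]card_ord -cardsT; apply: (@ncard_set _ _ _ (h \o f)).
  by move=> i j _ _ /= /hinj E; apply: finj; apply: E.
move=> y; split=> [/hQ[x /Pf[i <-] <-]|[i _ <-]]; first by exists i.
by apply/hQ; exists (f i).
Qed.

Lemma ncardD (T : Type) (P Q : T -> Prop) n k :
  ncard P n -> ncard (fun x => P x /\ Q x) k ->
  ncard (fun x => P x /\ ~ Q x) (n - k).
Proof.
move=> [f [finj [fP Pf]]] hk.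
pose A := [set i | `[< Q (f i) >]].
have fA (B : {set 'I_n}) : {in B &, injective f} by move=> i j _ _ /finj.
have hA : ncard (fun x => P x /\ Q x) #|A|.
  apply: (@ncard_set _ _ _ f) => // x; split=> [[/Pf[i <-] Qx]|[i]].
    by exists i; rewrite // inE; apply/asboolP.
  by rewrite inE => /asboolP Q_ <-; split.
rewrite (ncard_inj hk hA) -[X in (X - _)%N]card_ord -cardsT -cardsDS ?subsetT // setTD.
apply: (@ncard_set _ _ _ f) => // x; split=> [[/Pf[i <-] Qx]|[i]].
  by exists i; rewrite // !inE; apply/asboolPn.
by rewrite !inE => /asboolPn Q_ <-; split.
Qed.

Lemma ncard0 (T : Type) (P : T -> Prop) : (forall x, ~ P x) -> ncard P 0.
Proof.
move=> P0; rewrite -(@cards0 'I_0).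
apply: (@ncard_set _ _ _ (fun i : 'I_0 => match i with Ordinal k H => match notF H with end end)).
  by case.
by move=> x; split=> [/P0|[[]]].
Qed.

Lemma ncard1 (T : Type) (a : T) : ncard (fun x => x = a) 1.
Proof. by exists (fun=> a); split=> [i j|]; [rewrite !ord1|split=> // x ->; exists ord0]. Qed.

Lemma ncardU (T : Type) (P Q : T -> Prop) m n :
  (forall x, P x -> Q x -> False) -> ncard P m -> ncard Q n ->
  ncard (fun x => P x \/ Q x) (m + n).
Proof.
move=> dPQ [f [finj [fP Pf]]] [g [ginj [gQ Qg]]].
rewrite -[m]card_ord -[n in (_ + n)%N]card_ord -card_sum -cardsT.
apply: (@ncard_set _ _ _ (fun x => match x with inl i => f i | inr j => g j end)).
  move=> [i|i] [j|j] _ _ E; first by rewrite (finj _ _ E).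
  - by case: (dPQ (f i)) => //; rewrite E.
  - by case: (dPQ (f j)) => //; rewrite -E.
  - by rewrite (ginj _ _ E).
move=> x; split=> [[/Pf[i <-]|/Qg[i <-]]|[[i|i] _ <-]].
- by exists (inl i).
- by exists (inr i).
- by left.
- by right.
Qed.

Lemma ncard_bigU (T : Type) m (Q : 'I_m -> T -> Prop) (n : 'I_m -> nat) :
  (forall i j x, Q i x -> Q j x -> i = j) -> (forall i, ncard (Q i) (n i)) ->
  ncard (fun x => exists i, Q i x) (\sum_i n i).
Proof.
elim: m Q n => [|m IH] Q n dQ hQ.
  by rewrite big_ord0; apply: ncard0 => x [[]].
rewrite big_ord_recl.
have IH' := IH (fun i => Q (lift ord0 i)) _
  (fun i j x qi qj => lift_inj (dQ _ _ _ qi qj)) (fun i => hQ (lift ord0 i)).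
apply: ncard_ext (ncardU _ (hQ ord0) IH') => x; last first.
  by move=> q0 [i qi]; have := dQ _ _ _ q0 qi.
split=> [[q|[i q]]|[i]]; [by exists ord0|by exists (lift ord0 i)|].
by case: (unliftP ord0 i) => [j|] -> q; [right; exists j|left].
Qed.

(** Serves to count walks by their first step: [x] is the next vertex, [y] the rest of the walk, and
    all next vertices of one level leave the same number [n] of continuations. *)
Lemma ncard_sigma (T U W : Type) (P : T -> Prop) (Q : T -> U -> Prop)
    (h : T -> U -> W) m n :
  (forall x x' y y', h x y = h x' y' -> x = x' /\ y = y') ->
  ncard P m -> (forall x, P x -> ncard (Q x) n) ->
  ncard (fun z => exists x y, [/\ P x, Q x y & z = h x y]) (m * n).
Proof.
move=> hinj [f [finj [fP Pf]]] hQ.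
rewrite -[m]card_ord -sum_nat_const.
have := @ncard_bigU _ m (fun i z => exists2 y, Q (f i) y & h (f i) y = z) (fun=> n).
move=> /(_ _ _)/(ncard_ext _); apply.
- move=> z; split=> [[i [y q <-]]|[x [y [/Pf[i <-] q ->]]]]; last by exists i, y.
  by exists (f i), y.
- by move=> i j z [y _ <-] [y' _ /hinj[/finj->]].
- by move=> i; apply: (ncard_map (h := h (f i))) (hQ _ (fP i)) => // y y' _ _ /hinj[].
Qed.

(** * Counting walks without backtracking *)

Section Walks.
Variables (V : Type) (adj : V -> V -> Prop) (bk : V -> V).

(** [forb] is the vertex excluded for the next step. After a step out of [u] it is [bk u], which
    will be $u$ in the volcano and $p^{-1}u$ for lattices. *)
Fixpoint nbpath (forb : option V) (u : V) (s : seq V) : Prop :=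
  if s is v :: s' then [/\ adj u v, Some v <> forb & nbpath (Some (bk u)) v s']
  else True.

Definition nbwalk (v0 : V) (c : nat) (s : seq V) : Prop :=
  size s = c.+1 /\ head v0 s = v0 /\
  (forall i, (i.+1 < size s)%N -> adj (nth v0 s i) (nth v0 s i.+1)) /\
  (forall i, (i.+2 < size s)%N -> nth v0 s i.+2 <> bk (nth v0 s i)).

Lemma nbpathP x0 u forb s :
  nbpath forb u s <->
  [/\ forall i, (i < size s)%N -> adj (nth x0 (u :: s) i) (nth x0 s i),
      ohead s = None \/ ohead s <> forb &
      forall i, (i.+1 < size s)%N -> nth x0 s i.+1 <> bk (nth x0 (u :: s) i)].
Proof.
elim: s u forb => [|v s IH] u forb /=.
  by split=> // _; split=> //; left.
split=> [[uv vf /IH[h1 h2 h3]]|[h1 h2 h3]].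
  split; [by case|by right|].
  case=> [|i] /= si; last exact: h3.
  by case: s si h2 {IH h1 h3} => //= w s _ [//|h E]; apply: h; rewrite E.
split; [exact: (h1 0%N)|by case: h2|apply/IH; split].
- by move=> i si; apply: (h1 i.+1).
- case: s h3 {IH h1} => [|w s] h3; [by left|right=> /= -[E]].
  exact: (h3 0%N isT).
- by move=> i si; apply: (h3 i.+1).
Qed.

Lemma nbwalkP v0 c s :
  nbwalk v0 c s <-> exists2 s', size s' = c /\ nbpath None v0 s' & v0 :: s' = s.
Proof.
split=> [|[s' [ss' /(nbpathP v0)[h1 _ h3]] <-]].
  case: s => [|u s] [//= [ss] [uv0 [h1 h3]]]; rewrite {}uv0 in h1 h3 *.
  exists s => //; split=> //; apply/(nbpathP v0); split.
  - by move=> i; exact: h1.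
  - by case: (s) => [|w t]; [left|right].
  - by move=> i; exact: h3.
by split; [rewrite /= ss'|].
Qed.

Variables (lev : V -> nat -> Prop) (N : nat -> nat -> nat).

(** Here [forb] is only the level of the excluded vertex, so one neighbour of that level is removed.
    A neighbour is at most one level higher, hence the range [j.+2]; the vertex excluded next has
    level [j] because [bk] preserves levels. *)
Fixpoint nb_count (c j : nat) (forb : option nat) (b : nat) : nat :=
  if c is c'.+1 then
    \sum_(l < j.+2) (N j l - (forb == Some (val l))) * nb_count c' l (Some j) b
  else (j == b).

Hypothesis lev_fun : forall v i j, lev v i -> lev v j -> i = j.
Hypothesis lev_adj : forall u v j, lev u j -> adj u v ->
  exists2 l, (l < j.+2)%N & lev v l.
Hypothesis lev_bk : forall u j, lev u j -> lev (bk u) j.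
Hypothesis adj_bk : forall u v j, lev u j -> adj u v -> adj v (bk u).
Hypothesis ncard_adj : forall u j l, lev u j ->
  ncard (fun v => adj u v /\ lev v l) (N j l).

(** Induction on [c], splitting by the level of the vertex after [u]. The subtraction is exact
    because the excluded vertex is a neighbour of [u], an invariant kept by [adj_bk] and
    [lev_bk]. *)
Lemma ncard_nbpath c u j forb oj b :
  lev u j ->
  match forb, oj with
  | None, None => True | Some w, Some i => adj u w /\ lev w i | _, _ => False
  end ->
  ncard (fun s => [/\ size s = c, nbpath forb u s & lev (last u s) b])
        (nb_count c j oj b).
Proof.
elim: c u j forb oj => [|c IH] u j forb oj uj fo.
  rewrite /=; case: eqP => [<-|jb]; last first.
    by apply: ncard0 => -[|x s] [] //= _ _ /(lev_fun uj).
  by apply: ncard_ext (ncard1 [::]) => s; split=> [->|[/size0nil]] //.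
rewrite [nb_count _ _ _ _]/=.
pose Q (l : 'I_j.+2) s := exists v s',
  [/\ (adj u v /\ lev v l) /\ Some v <> forb,
      [/\ size s' = c, nbpath (Some (bk u)) v s' & lev (last v s') b] & s = v :: s'].
have Qn (l : 'I_j.+2) :
    ncard (Q l) ((N j l - (oj == Some (val l))) * nb_count c l (Some j) b).
  apply: (@ncard_sigma _ _ _ (fun v => (adj u v /\ lev v l) /\ Some v <> forb)
    (fun v s' => [/\ size s' = c, nbpath (Some (bk u)) v s' & lev (last v s') b])
    cons) => [x x' y y' [] //||v [[uv vl] _]].
    apply: ncardD; first exact: ncard_adj.
    case: forb oj fo {Q} => [w|] [i|] //= => [[uw wi]|_]; last first.
      by apply: ncard0 => v [].
    case: eqP => [[il]|il].
      apply: ncard_ext (ncard1 w) => v.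
      by split=> [->|[_ []] //]; rewrite -il.
    by apply: ncard0 => v [[_ vl] [vw]]; rewrite vw in vl; case: il; rewrite (lev_fun wi vl).
  apply: IH => //; split; [exact: adj_bk uj uv|exact: lev_bk].
apply: ncard_ext (ncard_bigU _ Qn) => [s|l l' s]; last first.
  move=> [v [s' [[[_ vl] _] _ ->]]] [v' [s'' [[[_ vl'] _] _ [E _]]]].
  by apply: val_inj; apply: lev_fun vl _; rewrite E.
split=> [[l [v [s' [[[uv vl] vf] [ss' ps' lb] ->]]]]|[]].
  by split; rewrite //= ss'.
case: s => [|v s'] //= [ss'] [uv vf ps'] lb.
have [l lj vl] := lev_adj uj uv.
by exists (Ordinal lj), v, s'; split.
Qed.

Lemma ncard_nbwalk v0 a c b : lev v0 a ->
  ncard (fun s => nbwalk v0 c s /\ lev (last v0 s) b) (nb_count c a None b).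
Proof.
move=> v0a; have := @ncard_nbpath c v0 a None None b v0a I.
apply: (ncard_map (h := cons v0)) => [x y _ _ [] //|s].
split=> [[/nbwalkP[s' [ss' ps'] <-] lb]|[s' [ss' ps' lb] <-]]; first by exists s'.
by split=> //; apply/nbwalkP; exists s'.
Qed.

End Walks.

(** * Neighbours in the volcano, level by level *)

(** The rim has $2+\chi_K(p)$ vertices, one more than [nroots d p]; this gives the two values for
    [j = 0]. *)
Definition volcano_degree (d p j l : nat) : nat :=
  if j is j'.+1 then (if l == j' then 1 else if l == j.+1 then p else 0)
  else if l == 0 then nroots d p else if l == 1 then p.+1 - nroots d p else 0.

Lemma ncard_volcano_adj d p V (adj : V -> V -> Prop) level :
  is_volcano d p adj level ->
  forall u j l, level u = j ->
  ncard (fun v => adj u v /\ level v = l) (volcano_degree d p j l).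
Proof.
move=> [asym [airr [areg [rimN [rimC [up lv]]]]]] u j l <- {j}.
have rim : level u = 0%N ->
    ncard (fun v => adj u v /\ level v = 0%N) (nroots d p).
  move=> u0; have -> : nroots d p = (`|(2 + chiK d p)%R|%N - 1)%N.
    by rewrite /chiK; lia.
  (* The rim is complete, so the neighbours of [u] in it are all its vertices but [u]. *)
  apply: ncard_ext (ncardD (Q := fun v => v = u) rimN _) => [v|].
    split=> [[v0 vu]|[uv v0]].
      by split=> //; apply: rimC => // uv; apply: vu.
    by split=> // E; apply: (airr u); rewrite E in uv.
  by apply: ncard_ext (ncard1 u) => v; split=> [->|[]].
case uE : (level u) => [|j] /=.
  case: eqP => [->|l0]; first exact: rim.
  case: eqP => [->|l1].
    apply: ncard_ext (ncardD (areg u) (rim uE)) => v.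
    split=> [[uv v0]|[uv ->]] //; split=> //.
    by case: (lv _ _ uv) => [[]|[]]; rewrite uE.
  by apply: ncard0 => v [uv vl]; case: (lv _ _ uv) => [[]|[]]; rewrite uE vl; lia.
have up' : ncard (fun v => adj u v /\ level v = j) 1.
  by have := up u; rewrite uE; apply.
case: eqP => [->|lj] //.
case: eqP => [->|lj2].
  rewrite -[p in ncard _ p](subn1 p.+1).
  apply: ncard_ext (ncardD (areg u) up') => v.
  split=> [[uv vj]|[uv ->]]; split=> //; last by lia.
  by case: (lv _ _ uv) => [[]|[]]; rewrite uE //; lia.
by apply: ncard0 => v [uv vl]; case: (lv _ _ uv) => [[]|[]]; rewrite uE vl; lia.
Qed.

Lemma ncard_volcano_walk d p V (adj : V -> V -> Prop) level v0 a b c :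
  is_volcano d p adj level -> level v0 = a ->
  ncard (fun s => nb_walk adj v0 c s /\ level (last v0 s) = b)
        (nb_count (volcano_degree d p) c a None b).
Proof.
move=> hG v0a; have [asym [_ [_ [_ [_ [_ lv]]]]]] := hG.
have := @ncard_nbwalk V adj id (fun v j => level v = j) (volcano_degree d p)
  _ _ _ _ _ v0 a c b v0a.
move=> /(_ _ _ _ _ _)/(ncard_ext _); apply => //.
(* With [bk] the identity, the two notions of walk differ only in the orientation of the
   inequality. *)
- move=> s; split=> -[[h1 [h2 [h3 h4]]] lb]; split=> //; split=> //; split=> //;
    by split=> // i si E; apply: (h4 i si).
- by move=> v i j <-.
- by move=> u v j uj uv; exists (level v) => //; case: (lv _ _ uv) => [[]|[]]; lia.
- by move=> u v j _; exact: asym.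
- exact: ncard_volcano_adj.
Qed.

Local Open Scope ring_scope.

(** * Lattices and their superlattices of index p *)

Definition kqscale (r : rat) (u : K) : K := (r * u.1, r * u.2).
Definition kdet (u v : K) : rat := u.1 * v.2 - u.2 * v.1.

Definition zspan (e1 e2 : K) : K -> Prop :=
  fun z => exists m1 m2 : int, z = kadd (kzscale m1 e1) (kzscale m2 e2).

Definition adjoin (L : K -> Prop) (g : K) : K -> Prop :=
  fun z => exists (k : int) (w : K), L w /\ z = kadd w (kzscale k g).

Definition has_order (L : K -> Prop) (g : K) (N : nat) : Prop :=
  forall k : int, L (kzscale k g) <-> (Posz N %| k)%Z.

Definition subgroup (L : K -> Prop) : Prop :=
  [/\ L (0, 0), forall u v, L u -> L v -> L (kadd u v)
    & forall k u, L u -> L (kzscale k u)].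

Lemma K_ext (u v : K) : u.1 = v.1 -> u.2 = v.2 -> u = v.
Proof. by case: u v => [? ?] [? ?] /= -> ->. Qed.

Ltac kring := apply: K_ext; rewrite /kqscale /kadd /kzscale /=; ring.
Ltac kfield := apply: K_ext; rewrite /kqscale /kadd /kzscale /=; field.

(** Lattices are predicates, and [ncard] counts them up to equality; extensionality makes mutual
    inclusion suffice. *)
Lemma eq_pred (L L' : K -> Prop) : (forall z, L z -> L' z) -> (forall z, L' z -> L z) -> L = L'.
Proof. by move=> h h'; apply/funext => z; apply/propext; split; [exact: h|exact: h']. Qed.

Lemma cyclic_quotientP L L' N :
  cyclic_quotient L L' N <-> exists2 g, has_order L g N & L' = adjoin L g.
Proof.
split=> [[g [h1 h2]]|[g h ->]]; exists g => //.
by apply: eq_pred => z /h1.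
Qed.

Lemma subgroup_adjoin L g : subgroup L -> subgroup (adjoin L g).
Proof.
case=> L0 LD LZ; split.
- by exists 0, (0, 0); split=> //; kring.
- move=> _ _ [k [w [Lw ->]]] [k' [w' [Lw' ->]]].
  by exists (k + k'), (kadd w w'); split; [exact: LD|kring].
- move=> j _ [k [w [Lw ->]]].
  by exists (j * k), (kzscale j w); split; [exact: LZ|kring].
Qed.

Lemma subgroup_zspan e1 e2 : subgroup (zspan e1 e2).
Proof.
split.
- by exists 0, 0; kring.
- by move=> _ _ [a [b ->]] [a' [b' ->]]; exists (a + a'), (b + b'); kring.
- by move=> k _ [a [b ->]]; exists (k * a), (k * b); kring.
Qed.

Lemma sub_adjoin L g z : L z -> adjoin L g z.
Proof. by exists 0, z; split=> //; kring. Qed.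

Lemma mem_adjoin L g : subgroup L -> adjoin L g g.
Proof. by case=> L0 _ _; exists 1, (0, 0); split=> //; kring. Qed.

Lemma adjoin_min L L' g : subgroup L' -> (forall z, L z -> L' z) -> L' g ->
  forall z, adjoin L g z -> L' z.
Proof. by move=> [_ LD LZ] LL' Lg _ [k [w [Lw ->]]]; apply: LD; [exact: LL'|exact: LZ]. Qed.

Lemma zspan_min L e1 e2 : subgroup L -> L e1 -> L e2 -> forall z, zspan e1 e2 z -> L z.
Proof. by move=> [_ LD LZ] L1 L2 _ [k [l ->]]; apply: LD; exact: LZ. Qed.

Lemma mem_zspan1 e1 e2 : zspan e1 e2 e1.
Proof. by exists 1, 0; kring. Qed.

Lemma mem_zspan2 e1 e2 : zspan e1 e2 e2.
Proof. by exists 0, 1; kring. Qed.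

Lemma zspanC e1 e2 : zspan e1 e2 = zspan e2 e1.
Proof. by apply: eq_pred => _ [a [b ->]]; exists b, a; kring. Qed.

Lemma is_latticeP L : is_lattice L <-> exists e1 e2, kdet e1 e2 != 0 /\ L = zspan e1 e2.
Proof.
split=> [[e1 [e2 [D h]]]|[e1 [e2 [D ->]]]]; exists e1, e2; split=> //.
by apply: eq_pred => z /h.
Qed.

Lemma lin_indep e1 e2 r1 r2 s1 s2 : kdet e1 e2 != 0 ->
  kadd (kqscale r1 e1) (kqscale r2 e2) = kadd (kqscale s1 e1) (kqscale s2 e2) ->
  r1 = s1 /\ r2 = s2.
Proof.
rewrite /kdet; case: e1 e2 => [x1 y1] [x2 y2] /= D [] /= E1 E2.
have h1 : (x1 * y2 - y1 * x2) * (r1 - s1) = 0.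
  transitivity (y2 * ((r1 * x1 + r2 * x2) - (s1 * x1 + s2 * x2)) -
                x2 * ((r1 * y1 + r2 * y2) - (s1 * y1 + s2 * y2))); first by ring.
  by rewrite E1 E2; ring.
have h2 : (x1 * y2 - y1 * x2) * (r2 - s2) = 0.
  transitivity (x1 * ((r1 * y1 + r2 * y2) - (s1 * y1 + s2 * y2)) -
                y1 * ((r1 * x1 + r2 * x2) - (s1 * x1 + s2 * x2))); first by ring.
  by rewrite E1 E2; ring.
move: h1 h2 => /eqP; rewrite mulf_eq0 (negPf D) /= subr_eq0 => /eqP -> /eqP.
by rewrite mulf_eq0 (negPf D) /= subr_eq0 => /eqP.
Qed.

Lemma mem_zspan_lin e1 e2 r1 r2 : kdet e1 e2 != 0 ->
  zspan e1 e2 (kadd (kqscale r1 e1) (kqscale r2 e2)) ->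
  exists m1 m2 : int, r1 = m1%:~R /\ r2 = m2%:~R.
Proof. by move=> D [m1 [m2 /(lin_indep D)]]; exists m1, m2. Qed.

(** * Superlattices of index p and the projective line over F_p *)

Section PrimeIndex.
Variables (p : nat) (hp : prime p).

Let p0 : p%:~R != 0 :> rat.
Proof. by rewrite intr_eq0; have := prime_gt0 hp; lia. Qed.

Definition superlat (e1 e2 : K) : K -> Prop := zspan (kqscale (p%:~R)^-1 e1) e2.

Lemma kdet_superlat e1 e2 : kdet e1 e2 != 0 -> kdet (kqscale (p%:~R)^-1 e1) e2 != 0.
Proof.
have -> : kdet (kqscale (p%:~R)^-1 e1) e2 = (p%:~R)^-1 * kdet e1 e2.
  by rewrite /kdet /kqscale /=; ring.
by move=> D; rewrite mulf_neq0 ?invr_eq0.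
Qed.

Lemma zspan_divr_order e1 e2 (x y : int) : kdet e1 e2 != 0 ->
  zspan e1 e2 (kqscale (p%:~R)^-1 (kadd (kzscale x e1) (kzscale y e2))) <->
  (p %| x)%Z /\ (p %| y)%Z.
Proof.
move=> D; split=> [|[/dvdzP[a ->] /dvdzP[b ->]]]; last first.
  by exists a, b; kfield.
have -> : kqscale (p%:~R)^-1 (kadd (kzscale x e1) (kzscale y e2)) =
  kadd (kqscale (x%:~R / p%:~R) e1) (kqscale (y%:~R / p%:~R) e2) by kring.
move=> /(mem_zspan_lin D)[m1 [m2 [h1 h2]]].
split; apply/dvdzP; [exists m1|exists m2]; apply: (@intr_inj rat).
  by rewrite rmorphM /= -h1 divfK.
by rewrite rmorphM /= -h2 divfK.
Qed.

Lemma coprime_bezout (x : int) n : ~~ (p %| x)%Z ->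
  exists u v : int, u * x + v * (p ^ n)%N = 1.
Proof.
move=> px; have [u [v E]] := Bezoutz x (p ^ n)%N; exists u, v.
rewrite E; apply/eqP; rewrite -[_ == _]/(coprimez x (p ^ n)%N).
rewrite coprimezE /= coprime_sym coprimeXl //.
by rewrite prime_coprime // -[p]/(`|Posz p|%N).
Qed.

(** Modulo the lattice the adjoined vector is $x e_1/p$ with $x$ invertible modulo $p$, so it
    generates the same group as $e_1/p$. *)
Lemma zspan_adjoin_div e1 e2 (x y : int) : ~~ (p %| x)%Z -> (p %| y)%Z ->
  adjoin (zspan e1 e2) (kqscale (p%:~R)^-1 (kadd (kzscale x e1) (kzscale y e2))) =
  superlat e1 e2.
Proof.
move=> px /dvdzP[y' ->]; have [u [v uv]] := coprime_bezout 1 px.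
rewrite expn1 in uv.
apply: eq_pred.
  apply: adjoin_min; first exact: subgroup_zspan.
    apply: zspan_min; [exact: subgroup_zspan| |exact: mem_zspan2].
    by exists p, 0; kfield.
  by exists x, y'; kfield.
apply: zspan_min; first exact/subgroup_adjoin/subgroup_zspan.
  (* With $g$ the adjoined vector and $ux + vp = 1$, one has $e_1/p = ug + ve_1 - uy'e_2$. *)
  exists u, (kadd (kzscale v e1) (kzscale (- (u * y')) e2)); split.
    by exists v, (- (u * y')).
  have E : u%:~R * x%:~R + v%:~R * p%:~R = 1 :> rat.
    by rewrite -!rmorphM -rmorphD /= uv.
  have xE : v%:~R = (1 - u%:~R * x%:~R) / p%:~R :> rat by apply: (mulIf p0); rewrite divfK //; lra.
  by apply: K_ext; rewrite /kqscale /kadd /kzscale /= xE; field.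
exact/sub_adjoin/mem_zspan2.
Qed.

Lemma cyclic_superlat e1 e2 : kdet e1 e2 != 0 ->
  cyclic_quotient (zspan e1 e2) (superlat e1 e2) p.
Proof.
move=> D; apply/cyclic_quotientP.
have p1 : ~~ (p %| 1)%Z by rewrite dvdz1 /=; have := prime_gt1 hp; lia.
have p00 : (p %| 0)%Z by rewrite dvdz0.
exists (kqscale (p%:~R)^-1 (kadd (kzscale 1 e1) (kzscale 0 e2))); last first.
  by rewrite zspan_adjoin_div.
move=> k; have := zspan_divr_order k 0 D.
have -> : kqscale (p%:~R)^-1 (kadd (kzscale k e1) (kzscale 0 e2)) =
  kzscale k (kqscale (p%:~R)^-1 (kadd (kzscale 1 e1) (kzscale 0 e2))) by kring.
by move=> ->; split=> [[]|].
Qed.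

(* The points of the projective line over F_p, each completed to a Z-basis. *)
Definition dirb (e1 e2 : K) (i : option 'F_p) : K * K :=
  if i is Some k then (kadd (kzscale (Posz (k : nat)) e1) e2, kzscale (-1) e1)
  else (e1, e2).

Lemma kdet_dirb e1 e2 i : kdet (dirb e1 e2 i).1 (dirb e1 e2 i).2 = kdet e1 e2.
Proof. by case: i => [k|] //=; rewrite /kdet /kadd /kzscale /=; ring. Qed.

Lemma zspan_dirb e1 e2 i : zspan (dirb e1 e2 i).1 (dirb e1 e2 i).2 = zspan e1 e2.
Proof.
case: i => [k|] //; apply: eq_pred => _ [a [b ->]] /=.
  by exists (a * (k : nat) - b), a; kring.
by exists b, (b * (k : nat) - a); kring.
Qed.

Definition superdir e1 e2 i := superlat (dirb e1 e2 i).1 (dirb e1 e2 i).2.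

Lemma Fp_int_eq0 (x : int) : (x%:~R == 0 :> 'F_p) = (p %| x)%Z.
Proof.
have nat0 n : (n%:R == 0 :> 'F_p) = (p %| n)%N.
  by rewrite -(dvdn_pcharf (pchar_Fp hp)).
by case: x => n; rewrite ?NegzE ?rmorphN /= ?oppr_eq0 nat0.
Qed.

Lemma Fp_int_repr (k : 'F_p) : (Posz (k : nat))%:~R = k.
Proof. exact: natr_Zp. Qed.

(** The first basis vector of direction [i], divided by $p$, lies in the superlattice of direction
    [j]. Comparing coordinates gives equal residues, or $p \mid 1$ if exactly one direction is
    [None]. *)
Lemma superdir_inj e1 e2 : kdet e1 e2 != 0 -> injective (superdir e1 e2).
Proof.
move=> D i j ij.
have mem : superdir e1 e2 j (kqscale (p%:~R)^-1 (dirb e1 e2 i).1).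
  by rewrite -ij; exact: mem_zspan1.
have p1 := prime_gt1 hp.
case: i j {ij} mem => [k|] [l|] //= [a [b E]].
- have [h1 h2] : (k : nat)%:~R / p%:~R = a%:~R * (l : nat)%:~R / p%:~R - b%:~R :> rat
      /\ (p%:~R)^-1 = a%:~R / p%:~R :> rat.
    apply: (lin_indep D); apply: (etrans (etrans _ E)); kring.
  have a1 : a = 1.
    by apply: (@intr_inj rat); rewrite -(divfK p0 a%:~R) -h2 mulVf.
  congr Some; rewrite -(Fp_int_repr k) -(Fp_int_repr l); apply/eqP.
  rewrite -subr_eq0 -rmorphB /= Fp_int_eq0; apply/dvdzP; exists (- b).
  apply: (@intr_inj rat); rewrite rmorphB rmorphM rmorphN /=.
  have -> : (k : nat)%:~R = ((k : nat)%:~R / p%:~R) * p%:~R :> rat by rewrite divfK.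
  by rewrite h1 a1; field.
- have [h1 h2] : (k : nat)%:~R / p%:~R = a%:~R / p%:~R :> rat
      /\ (p%:~R)^-1 = b%:~R :> rat.
    apply: (lin_indep D); apply: (etrans (etrans _ E)); kring.
  have : b * p = 1 by apply: (@intr_inj rat); rewrite rmorphM /= -h2 mulVf.
  by move=> {}h2; have : (p %| 1)%Z by [apply/dvdzP; exists b]; rewrite dvdz1 /=; lia.
- have [h1 h2] : (p%:~R)^-1 = a%:~R * (l : nat)%:~R / p%:~R - b%:~R :> rat
      /\ 0 = a%:~R / p%:~R :> rat.
    apply: (lin_indep D); apply: (etrans (etrans _ E)); kring.
  have a0 : a = 0.
    by apply: (@intr_inj rat); rewrite -(divfK p0 a%:~R) -h2 mul0r.
  have : - b * p = 1.
    apply: (@intr_inj rat); rewrite rmorphM rmorphN /=.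
    by move: h1; rewrite a0 !mul0r sub0r => <-; rewrite mulVf.
  by move=> {}h2; have : (p %| 1)%Z by [apply/dvdzP; exists (- b)]; rewrite dvdz1 /=; lia.
Qed.

(** A generator $g$ of order $p$ has $pg = xe_1 + ye_2$ with $x, y$ not both divisible by $p$, and
    only the point $(x:y)$ modulo $p$ matters. *)
Lemma superdirP e1 e2 L' : kdet e1 e2 != 0 ->
  cyclic_quotient (zspan e1 e2) L' p <-> exists i, superdir e1 e2 i = L'.
Proof.
move=> D; split=> [/cyclic_quotientP[g og ->]|[i <-]]; last first.
  by rewrite -(zspan_dirb e1 e2 i); apply: cyclic_superlat; rewrite kdet_dirb.
have [x [y E]] : zspan e1 e2 (kzscale p g) by apply/og.
have {E} gE : g = kqscale (p%:~R)^-1 (kadd (kzscale x e1) (kzscale y e2)).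
  by rewrite -E; kfield.
have [py|py] := boolP (p %| y)%Z.
  have [px|px] := boolP (p %| x)%Z.
    have /og : zspan e1 e2 (kzscale 1 g).
      have -> : kzscale 1 g = g by kring.
      by rewrite gE; apply/zspan_divr_order.
    by rewrite dvdz1 /=; have := prime_gt1 hp; lia.
  by exists None; rewrite gE zspan_adjoin_div.
have yF : y%:~R != 0 :> 'F_p by rewrite Fp_int_eq0.
have [k kE] : exists k : 'F_p, y%:~R * k = x%:~R.
  by exists (x%:~R / y%:~R); rewrite mulrC divfK.
have kd : (p %| y * (k : nat) - x)%Z.
  by rewrite -Fp_int_eq0 rmorphB rmorphM /= Fp_int_repr kE subrr.
exists (Some k).
(* In the basis of direction [k], the coordinates of $pg$ are $y$ and $yk - x$; the second is
   divisible by $p$. *)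
rewrite -(zspan_dirb e1 e2 (Some k)) /superdir -(zspan_adjoin_div _ _ py kd) gE.
by congr adjoin; rewrite /=; kring.
Qed.

(** The lattice $p^{-1}L$, homothetic to $L$. *)
Definition shrink (L : K -> Prop) : K -> Prop := fun z => L (kzscale p z).

Lemma shrink_zspan e1 e2 :
  shrink (zspan e1 e2) = zspan (kqscale (p%:~R)^-1 e1) (kqscale (p%:~R)^-1 e2).
Proof.
apply: eq_pred => [z [a [b E]]|_ [a [b ->]]]; exists a, b; last by kfield.
have -> : z = kqscale (p%:~R)^-1 (kzscale p z) by kfield.
by rewrite E; kring.
Qed.

Lemma cyclic_quotient_basis L L' : is_lattice L -> cyclic_quotient L L' p ->
  exists e1 e2, [/\ kdet e1 e2 != 0, L = zspan e1 e2 & L' = superlat e1 e2].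
Proof.
move=> /is_latticeP[e1 [e2 [D ->]]] /(superdirP _ D)[i <-].
exists (dirb e1 e2 i).1, (dirb e1 e2 i).2.
by split; [rewrite kdet_dirb|rewrite zspan_dirb|].
Qed.

Lemma is_lattice_cyclic_quotient L L' : is_lattice L -> cyclic_quotient L L' p ->
  is_lattice L'.
Proof.
move=> hL /(cyclic_quotient_basis hL)[e1 [e2 [D _ ->]]].
by apply/is_latticeP; exists (kqscale (p%:~R)^-1 e1), e2; split; first exact: kdet_superlat.
Qed.

(** This is the dual isogeny: if $L'$ has basis $e_1/p, e_2$, then $p^{-1}L$ arises from it by
    dividing $e_2$ by $p$. *)
Lemma cyclic_quotient_shrink L L' : is_lattice L -> cyclic_quotient L L' p ->
  cyclic_quotient L' (shrink L) p.
Proof.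
move=> hL /(cyclic_quotient_basis hL)[e1 [e2 [D -> ->]]].
rewrite shrink_zspan zspanC /superlat (zspanC _ e2); apply: cyclic_superlat.
have -> : kdet e2 (kqscale (p%:~R)^-1 e1) = - kdet (kqscale (p%:~R)^-1 e1) e2.
  by rewrite /kdet; ring.
by rewrite oppr_eq0 kdet_superlat.
Qed.

End PrimeIndex.

(** * Cyclic quotients as chains without backtracking *)

Lemma kzscale_adjoin_sub L g g' (k : int) : subgroup L ->
  adjoin L g g' -> forall z, adjoin L (kzscale k g') z -> adjoin L (kzscale k g) z.
Proof.
move=> sL [j [w [Lw ->]]]; have [_ _ LZ] := sL.
apply: adjoin_min; [exact: subgroup_adjoin|exact: sub_adjoin|].
by exists j, (kzscale k w); split; [exact: LZ|kring].
Qed.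

(** The last lattice of a chain thus determines the earlier ones, whichever generator is chosen. *)
Lemma eq_kzscale_adjoin L g g' (k : int) : subgroup L ->
  adjoin L g = adjoin L g' -> adjoin L (kzscale k g) = adjoin L (kzscale k g').
Proof.
move=> sL E; apply: eq_pred; apply: kzscale_adjoin_sub => //.
  by rewrite -E; exact: mem_adjoin.
by rewrite E; exact: mem_adjoin.
Qed.

Lemma subgroup_lattice L : is_lattice L -> subgroup L.
Proof. by move=> /is_latticeP[e1 [e2 [_ ->]]]; exact: subgroup_zspan. Qed.

Section Chains.
Variables (p : nat) (hp : prime p).
Local Notation padj := (fun L L' => cyclic_quotient L L' p).

(** Both have the same prime index over [L]. Concretely $g = w + kh$ with $p \nmid k$, and inverting
    $k$ modulo $p$ puts $h$ in [A]. *)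
Lemma cyclic_quotient_sub_eq L A B : subgroup L ->
  cyclic_quotient L A p -> cyclic_quotient L B p -> (forall z, A z -> B z) -> A = B.
Proof.
move=> sL /cyclic_quotientP[g og ->] /cyclic_quotientP[h oh ->] AB.
apply: eq_pred => //.
apply: adjoin_min; [exact: subgroup_adjoin|exact: sub_adjoin|].
have [k [w [Lw gE]]] : adjoin L h g by apply: AB; exact: mem_adjoin.
have [_ LD LZ] := sL.
have pk : ~~ (p %| k)%Z.
  apply/negP => /oh Lk; have /og : L (kzscale 1 g).
    by apply: (LZ); rewrite gE; exact: LD.
  by rewrite dvdz1 /=; have := prime_gt1 hp; lia.
have [u [v uv]] := coprime_bezout hp 1 pk; rewrite expn1 in uv.
have Lp : L (kzscale p h) by apply/oh.
exists u, (kadd (kzscale (- u) w) (kzscale v (kzscale p h))).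
split; first by apply: LD; exact: LZ.
have uE : u%:~R * k%:~R = 1 - v%:~R * p%:~R :> rat.
  by rewrite -!rmorphM -[1]/(1%:~R) -uv /= -rmorphB /=; congr _%:~R; ring.
transitivity (kqscale (1 - v%:~R * p%:~R + v%:~R * p%:~R) h); first by kring.
by rewrite -uE gE; kring.
Qed.

Definition chain (Lam : K -> Prop) (c : nat) (g : K) : seq (K -> Prop) :=
  mkseq (fun i => adjoin Lam (kzscale (p ^ (c - i))%N g)) c.+1.

Lemma chain_nbwalk Lam c g : subgroup Lam -> has_order Lam g (p ^ c) ->
  nbwalk padj (shrink p) Lam c (chain Lam c g).
Proof.
move=> sL og; have [L0 LD LZ] := sL.
have sub k (w : K) : Lam (kadd w (kzscale k g)) -> Lam w -> Lam (kzscale k g).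
  move=> h Lw; have -> : kzscale k g = kadd (kadd w (kzscale k g)) (kzscale (-1) w).
    by kring.
  by apply: LD => //; exact: LZ.
have p0 : (0 < p)%N by exact: prime_gt0.
split; first by rewrite size_mkseq.
split.
  rewrite /chain /= subn0; apply: eq_pred => [|z]; last exact: sub_adjoin.
  by apply: adjoin_min => //; apply/og.
split=> i; rewrite size_mkseq => si; (rewrite !nth_mkseq; try by lia); last first.
  (* Write $n = c-i-2$. If $L_{i+2} = p^{-1}L_i$, then $p^{n+1}g$ lies in $L_i$, the lattice
     generated by [Lam] and $p^{n+2}g$; as $g$ has order $p^c$, this forces $p \mid 1$. *)
  have -> : (c - i)%N = (c - i.+2).+2 by lia.
  set n := (c - i.+2)%N => E.
  have : adjoin Lam (kzscale (p ^ n)%N g) (kzscale (p ^ n)%N g) by exact: mem_adjoin.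
  rewrite E => -[k [w [Lw wE]]].
  have /og : Lam (kzscale (Posz (p ^ n.+1) - k * Posz (p ^ n.+2)) g).
    rewrite (_ : kzscale _ _ = w) //.
    rewrite -[w](_ : kadd (kadd w (kzscale k (kzscale (p ^ n.+2)%N g)))
      (kzscale (- k * (p ^ n.+2)%N) g) = w); last by kring.
    by rewrite -wE expnS; kring.
  have -> : Posz (p ^ n.+1) - k * Posz (p ^ n.+2) = (1 - k * p) * (p ^ n.+1)%N.
    by rewrite ![(p ^ _.+1)%N]expnS; ring.
  have -> : (p ^ c = p ^ (c - n.+2) * p * p ^ n.+1)%N.
    by rewrite -expnSr -expnD; congr (_ ^ _)%N; lia.
  rewrite PoszM dvdz_mul2r; last by rewrite -lt0n expn_gt0 p0.
  move=> /dvdzP[q /eqP]; rewrite -subr_eq0 => /eqP E'.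
  have : (p %| 1)%Z by apply/dvdzP; exists (k + q * (p ^ (c - n.+2))%N); lia.
  by rewrite dvdz1 /=; have := prime_gt1 hp; lia.
have -> : (c - i)%N = (c - i.+1).+1 by lia.
set n := (c - i.+1)%N.
(* With $n = c-i-1$, the vector $p^n g$ has order $p$ modulo $L_i$ and generates $L_{i+1}$ over
   it. *)
apply/cyclic_quotientP; exists (kzscale (p ^ n)%N g); last first.
  apply: eq_pred.
    apply: adjoin_min; first exact/subgroup_adjoin/subgroup_adjoin.
      by move=> z Lz; do 2 apply: sub_adjoin.
    exact/mem_adjoin/subgroup_adjoin.
  apply: adjoin_min; [exact: subgroup_adjoin| |exact: mem_adjoin].
  apply: adjoin_min; [exact: subgroup_adjoin|exact: sub_adjoin|].
  by exists p, (0, 0); split=> //; rewrite expnS; kring.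
move=> k; split=> [[j [w [Lw wE]]]|/dvdzP[j ->]]; last first.
  by exists j, (0, 0); split=> //; rewrite expnS; kring.
have /og : Lam (kzscale ((k - j * p) * (p ^ n)%N) g).
  apply: (sub _ (kzscale (-1) w)); last exact: LZ.
  rewrite (_ : kadd _ _ = (0, 0)) //.
  rewrite (_ : kadd _ _ = kadd (kzscale k (kzscale (p ^ n)%N g)) (kzscale (-1)
     (kadd w (kzscale j (kzscale (p ^ n.+1)%N g))))); last by rewrite expnS; kring.
  by rewrite -wE; kring.
have -> : (p ^ c = p ^ (c - n.+1) * p * p ^ n)%N.
  by rewrite -expnSr -expnD; congr (_ ^ _)%N; lia.
rewrite PoszM dvdz_mul2r; last by rewrite -lt0n expn_gt0 p0.
move=> /dvdzP[q E]; apply/dvdzP; exists (j + q * (p ^ (c - n.+1))%N); lia.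
Qed.

(** Induction on the length, removing the last lattice. If it is generated over $L_c$ by $h$ with
    $ph = w + kg$, the absence of backtracking yields $p \nmid k$; then $ph$ replaces $g$ as a
    generator of $L_c$ and $h$ has order $p^{c+1}$. *)
Lemma nbwalk_chain Lam c s : is_lattice Lam -> nbwalk padj (shrink p) Lam c s ->
  (forall i, (i <= c)%N -> is_lattice (nth Lam s i)) /\
  exists2 g, has_order Lam g (p ^ c) & s = chain Lam c g.
Proof.
move=> lL; have sL := subgroup_lattice lL; have [L0 LD LZ] := sL.
elim: c s => [|c IH] s [ss [hs [sa sb]]].
  case: s ss hs {sa sb} => [|L [|]] //= _ ->; split; first by case.
  exists (0, 0).
    move=> k; split=> _; first by rewrite expn0 dvd1z.
    by rewrite (_ : kzscale _ _ = (0, 0)) //; kring.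
  rewrite /chain /=; congr cons; apply: eq_pred => z; first exact: sub_adjoin.
  by apply: adjoin_min => //; rewrite (_ : kzscale _ _ = (0, 0)) //; kring.
case/lastP: s ss hs sa sb => [|s L] //; rewrite size_rcons => -[ss] hs sa sb.
have s'E i : (i <= c)%N -> nth Lam (rcons s L) i = nth Lam s i.
  by move=> ic; rewrite nth_rcons ss ltnS ic.
have sL' : nth Lam (rcons s L) c.+1 = L by rewrite nth_rcons ss ltnn eqxx.
have [slat [g og sE]] : (forall i, (i <= c)%N -> is_lattice (nth Lam s i)) /\
  exists2 g, has_order Lam g (p ^ c) & s = chain Lam c g.
  apply: IH; split=> //; split; first by case: (s) ss hs.
  split=> i si; rewrite -!s'E; try lia.
    by apply: sa; lia.
  by apply: sb; lia.
have nthE i : (i <= c)%N -> nth Lam s i = adjoin Lam (kzscale (p ^ (c - i))%N g).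
  by move=> ic; rewrite sE nth_mkseq.
have gE1 : kzscale (p ^ 0)%N g = g by kring.
have cL : nth Lam s c = adjoin Lam g by rewrite nthE // subnn gE1.
have aL : cyclic_quotient (nth Lam s c) L p.
  by have := sa c; rewrite sL' s'E // ss; apply.
split.
  move=> i; rewrite leq_eqVlt => /orP[/eqP->|ic]; last by rewrite s'E //; exact: slat.
  by rewrite sL'; apply: is_lattice_cyclic_quotient aL => //; exact: slat.
have /cyclic_quotientP[h oh LE] := aL; rewrite cL in oh LE.
have [w [k [Lw hE pk]]] : exists w (k : int),
    [/\ Lam w, kzscale p h = kadd w (kzscale k g) & ~~ (p %| k)%Z].
  have [k [w [Lw hE]]] : adjoin Lam g (kzscale p h) by apply/oh.
  have [pk|pk] := boolP (p %| k)%Z; last by exists w, k.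
  (* For [c = 0] no vertex is excluded, but $g$ lies in [Lam], so $k$ can be replaced by 1. *)
  case: (posnP c) => c0.
    have Lg : Lam (kzscale (k - 1) g) by apply/og; rewrite c0 dvd1z.
    exists (kadd w (kzscale (k - 1) g)), 1; split; first exact: LD.
      by rewrite hE; kring.
    by rewrite dvdz1 /=; have := prime_gt1 hp; lia.
  (* For $c > 0$, $p \mid k$ would put [L] inside $p^{-1}L_{c-1}$. Both have index $p$ over $L_c$,
     so they would coincide and the walk would backtrack. *)
  case: (sb c.-1); first by rewrite ss; lia.
  have -> : c.-1.+2 = c.+1 by lia.
  rewrite sL' s'E; last by lia.
  have lc : is_lattice (nth Lam s c.-1) by apply: slat; lia.
  have ac : cyclic_quotient (nth Lam s c.-1) (nth Lam s c) p.
    have := sa c.-1; rewrite prednK // !s'E ?leq_pred // ss; apply; lia.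
  apply: cyclic_quotient_sub_eq aL (cyclic_quotient_shrink hp lc ac) _.
    exact/subgroup_lattice/slat.
  rewrite LE => z [j [y [[i [x [Lx ->]]] ->]]]; rewrite /shrink nthE; last by lia.
  have -> : (c - c.-1)%N = 1%N by lia.
  have /dvdzP[k' kE] := pk.
  exists (i + j * k'), (kadd (kzscale p x) (kzscale j w)); split.
    by apply: LD; exact: LZ.
  transitivity (kadd (kzscale p (kadd x (kzscale i g))) (kzscale j (kzscale p h))).
    by kring.
  by rewrite hE kE expn1; kring.
(* $k$ is invertible modulo $p^c$, the order of $g$. *)
have ghE : adjoin Lam g = adjoin Lam (kzscale p h).
  apply: eq_pred; apply: adjoin_min; try exact: subgroup_adjoin; try exact: sub_adjoin.
    have [u [v uv]] := coprime_bezout hp c pk.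
    have Lg : Lam (kzscale (p ^ c)%N g) by apply/og.
    exists u, (kadd (kzscale (- u) w) (kzscale v (kzscale (p ^ c)%N g))).
    split; first by apply: LD; exact: LZ.
    rewrite hE; have -> : g = kzscale 1 g by kring.
    by rewrite -{1}uv; kring.
  by exists k, w.
exists h.
  move=> j; split.
    move=> Lj; have /oh/dvdzP[j' jE] : adjoin Lam g (kzscale j h) by exact: sub_adjoin.
    have /og : Lam (kzscale (j' * k) g).
      have -> : kzscale (j' * k) g = kadd (kzscale j h) (kzscale (- j') w).
        rewrite jE; transitivity (kadd (kzscale j' (kzscale p h)) (kzscale (- j') w)).
          by rewrite hE; kring.
        by kring.
      by apply: LD => //; exact: LZ.
    rewrite Gauss_dvdzl; last first.
      rewrite coprimezE /= coprimeXl // prime_coprime //.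
    by rewrite jE expnSr PoszM => ?; apply: dvdz_mul.
  move=> /dvdzP[j' ->].
  have Lg : Lam (kzscale (p ^ c)%N g) by apply/og.
  have -> : kzscale (j' * (p ^ c.+1)%N) h =
      kadd (kzscale (j' * (p ^ c)%N) w) (kzscale (j' * k) (kzscale (p ^ c)%N g)).
    transitivity (kzscale (j' * (p ^ c)%N) (kzscale p h)); first by rewrite expnS; kring.
    by rewrite hE; kring.
  by apply: LD; exact: LZ.
rewrite /chain; apply: (@eq_from_nth _ Lam); first by rewrite size_rcons size_mkseq ss.
move=> i; rewrite size_rcons ss => ic; rewrite nth_mkseq //.
move: ic; rewrite !ltnS leq_eqVlt => /orP[/eqP->|ic].
  rewrite sL' subnn LE; have -> : kzscale (p ^ 0)%N h = h by kring.
  rewrite ghE; apply: eq_pred.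
    apply: adjoin_min; [exact: subgroup_adjoin| |exact: mem_adjoin].
    apply: adjoin_min; [exact: subgroup_adjoin|exact: sub_adjoin|].
    by exists p, (0, 0); split=> //; kring.
  apply: adjoin_min; first exact/subgroup_adjoin/subgroup_adjoin.
    by move=> z Lz; do 2 apply: sub_adjoin.
  exact/mem_adjoin/subgroup_adjoin.
rewrite s'E // nthE // subSn // expnSr.
rewrite (eq_kzscale_adjoin _ sL ghE); congr adjoin; kring.
Qed.

Lemma last_chain Lam c g x : last x (chain Lam c g) = adjoin Lam g.
Proof.
rewrite (last_nth Lam) /chain size_mkseq /= -[nth _ _ _]/(nth Lam (mkseq _ c.+1) c).
by rewrite nth_mkseq // subnn; congr adjoin; kring.
Qed.

Lemma ncard_cyclic_quotient Lam (Q : (K -> Prop) -> Prop) c n : is_lattice Lam ->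
  ncard (fun s => nbwalk padj (shrink p) Lam c s /\ Q (last Lam s)) n ->
  ncard (fun L' => cyclic_quotient Lam L' (p ^ c) /\ Q L') n.
Proof.
move=> lL; have sL := subgroup_lattice lL.
apply: (ncard_map (h := last Lam)) => [s t|L].
  move=> [/(nbwalk_chain lL)[_ [g og ->]] _] [/(nbwalk_chain lL)[_ [g' og' ->]] _].
  rewrite !last_chain => E; apply: eq_mkseq => i; exact: eq_kzscale_adjoin.
split=> [[/cyclic_quotientP[g og ->] QL]|[s [/(nbwalk_chain lL)[_ [g og ->]] QL] <-]].
  by exists (chain Lam c g); rewrite last_chain //; split=> //; exact: chain_nbwalk.
by move: QL; rewrite last_chain; split=> //; apply/cyclic_quotientP; exists g.
Qed.

End Chains.

(** * Conductors *)

(* The columns of the matrix of multiplication by m w in the basis (e1, e2) are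
   (m11, m21) and (m12, m22). *)
Definition omega_mx (d m : nat) (e1 e2 : K) (m11 m12 m21 m22 : int) : Prop :=
  kmul d (0, m%:~R) e1 = kadd (kzscale m11 e1) (kzscale m21 e2) /\
  kmul d (0, m%:~R) e2 = kadd (kzscale m12 e1) (kzscale m22 e2).

(** Applied to $m_{12}$, $m_{21}$, $m_{11}-m_{22}$: the matrix is scalar modulo no prime. *)
Definition primitive (x y z : int) : Prop :=
  forall q : nat, prime q -> (q %| x)%Z -> (q %| y)%Z -> (q %| z)%Z -> False.

Lemma primitive_bezout x y z : primitive x y z ->
  exists a b c : int, a * x + b * y + c * z = 1.
Proof.
move=> pr; pose g := gcdz (gcdz x y) z.
have gx : (g %| x)%Z by apply: dvdz_trans (dvdz_gcdl _ _) (dvdz_gcdl _ _).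
have gy : (g %| y)%Z by apply: dvdz_trans (dvdz_gcdl _ _) (dvdz_gcdr _ _).
have gz : (g %| z)%Z by apply: dvdz_gcdr.
have g1 : g = 1.
  have [//|/eqP g1] := eqVneq g 1; exfalso.
  have [q qp qg] : exists2 q, prime q & (q %| g)%Z.
    have [g2|g2] := ltnP 1 `|g|%N.
      by exists (pdiv `|g|); [exact: pdiv_prime|rewrite dvdzE /= pdiv_dvd].
    have gabs : g = `|g|%N by [].
    have g0 : g = 0 by move: (g) g1 g2 gabs => h; lia.
    by exists 2%N; rewrite // g0 dvdz0.
  by apply: (pr q qp); apply: dvdz_trans qg _.
have [u [v E]] := Bezoutz (gcdz x y) z; have [u' [v' E']] := Bezoutz x y.
by exists (u * u'), (u * v'), v; rewrite -g1 /g -E -E'; ring.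
Qed.

Section OmegaMatrix.
Variables (d m : nat) (e1 e2 : K).
Hypotheses (m_gt0 : (0 < m)%N) (D : kdet e1 e2 != 0).

Let m0 : m%:~R != 0 :> rat.
Proof. by rewrite intr_eq0; lia. Qed.

Lemma omega_mx_char m11 m12 m21 m22 : omega_mx d m e1 e2 m11 m12 m21 m22 ->
  m11 + m22 = Posz m * Posz (tw d) /\ m11 * m22 - m12 * m21 = Posz (m * m * nw d).
Proof.
move: D; rewrite /omega_mx /kdet /kmul /kadd /kzscale.
case: e1 e2 => [x1 y1] [x2 y2] /= DE [[A1 A2] [B1 B2]].
set E := x1 * y2 - y1 * x2 in DE.
(* Cramer's rule expresses each entry, times the determinant [E], by the coordinates of the
   basis. *)
have h11 : E * m11%:~R = (0 * x1 - (nw d)%:R * (m%:~R * y1)) * y2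
                       - (0 * y1 + m%:~R * x1 + (tw d)%:R * (m%:~R * y1)) * x2.
  by rewrite A1 A2 /E; ring.
have h21 : E * m21%:~R = x1 * (0 * y1 + m%:~R * x1 + (tw d)%:R * (m%:~R * y1))
                       - y1 * (0 * x1 - (nw d)%:R * (m%:~R * y1)).
  by rewrite A1 A2 /E; ring.
have h12 : E * m12%:~R = (0 * x2 - (nw d)%:R * (m%:~R * y2)) * y2
                       - (0 * y2 + m%:~R * x2 + (tw d)%:R * (m%:~R * y2)) * x2.
  by rewrite B1 B2 /E; ring.
have h22 : E * m22%:~R = x1 * (0 * y2 + m%:~R * x2 + (tw d)%:R * (m%:~R * y2))
                       - y1 * (0 * x2 - (nw d)%:R * (m%:~R * y2)).
  by rewrite B1 B2 /E; ring.
split; apply: (@intr_inj rat).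
  apply: (mulfI DE); rewrite rmorphD /= mulrDr h11 h22 /E; ring.
apply: (mulfI DE); apply: (mulfI DE).
transitivity ((E * m11%:~R) * (E * m22%:~R) - (E * m12%:~R) * (E * m21%:~R)); first by ring.
by rewrite h11 h12 h21 h22 /E; ring.
Qed.

(** Write $x + yw = x + (y/m)mw$. If it stabilises the lattice, the products of $y/m$ with $m_{12}$,
    $m_{21}$, $m_{11}-m_{22}$ are integers, so primitivity makes $y/m$ an integer. Conversely, a
    prime $q$ dividing all three would let $(mw - m_{11})/q$ stabilise the lattice, although $m/q$
    is no multiple of $m$. *)
Lemma has_conductorP :
  has_conductor d (zspan e1 e2) m <->
  exists m11 m12 m21 m22,
    omega_mx d m e1 e2 m11 m12 m21 m22 /\ primitive m12 m21 (m11 - m22).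
Proof.
split=> [[_ h]|[m11 [m12 [m21 [m22 [[A B] pr]]]]]]; last first.
  have act x y : forall u, kmul d (x, y) u =
      kadd (kqscale x u) (kqscale (y / m%:~R) (kmul d (0, m%:~R) u)).
    by move=> u; apply: K_ext; rewrite /kmul /kadd /kqscale /=; field.
  split=> // -[x y]; split; last first.
    move=> [a [_ [[b [c ->]] [-> ->]]]] _ [k [l ->]].
    exists ((a + Posz m * b) * k + c * (k * m11 + l * m12)),
           ((a + Posz m * b) * l + c * (k * m21 + l * m22)).
    rewrite act.
    have -> : kmul d (0, m%:~R) (kadd (kzscale k e1) (kzscale l e2)) =
        kadd (kzscale k (kmul d (0, m%:~R) e1)) (kzscale l (kmul d (0, m%:~R) e2)).
      by apply: K_ext; rewrite /kmul /kadd /kzscale /=; ring.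
    by rewrite A B; kfield.
  move=> st.
  have := st e1 (mem_zspan1 _ _); rewrite act A.
  have -> : kadd (kqscale x e1) (kqscale (y / m%:~R)
        (kadd (kzscale m11 e1) (kzscale m21 e2))) =
      kadd (kqscale (x + y / m%:~R * m11%:~R) e1)
           (kqscale (y / m%:~R * m21%:~R) e2) by kring.
  move=> /(mem_zspan_lin D)[k11 [k21 [h11 h21]]].
  have := st e2 (mem_zspan2 _ _); rewrite act B.
  have -> : kadd (kqscale x e2) (kqscale (y / m%:~R)
        (kadd (kzscale m12 e1) (kzscale m22 e2))) =
      kadd (kqscale (y / m%:~R * m12%:~R) e1)
           (kqscale (x + y / m%:~R * m22%:~R) e2) by kring.
  move=> /(mem_zspan_lin D)[k12 [k22 [h12 h22]]].
  have [a [b [c abc]]] := primitive_bezout pr.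
  pose n := a * k12 + b * k21 + c * (k11 - k22).
  have nE : n%:~R = y / m%:~R.
    rewrite /n !(rmorphB, rmorphD, rmorphM) /= -h11 -h12 -h21 -h22.
    transitivity (y / m%:~R * (a * m12 + b * m21 + c * (m11 - m22))%:~R); first by ring.
    by rewrite abc mulr1.
  exists (k11 - n * m11), (0, n%:~R); split; first by exists 0, n.
  rewrite /kadd /kzscale /=; congr pair.
    by rewrite rmorphB rmorphM /= nE -h11; ring.
  by rewrite nE; field.
have st : forall z, zspan e1 e2 z -> zspan e1 e2 (kmul d (0, m%:~R) z).
  apply/h; exists 0, (0, 1); split; first by exists 0, 1.
  by rewrite /kadd /kzscale /=; congr pair; ring.
have [m11 [m21 A]] := st e1 (mem_zspan1 _ _).
have [m12 [m22 B]] := st e2 (mem_zspan2 _ _).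
exists m11, m12, m21, m22; split=> // q qp /dvdzP[a aE] /dvdzP[b bE] /dvdzP[c cE].
have q0 : q%:~R != 0 :> rat by rewrite intr_eq0; have := prime_gt0 qp; lia.
have /h[x [_ [[y [n ->]] [_ nE]]]] : forall z, zspan e1 e2 z ->
    zspan e1 e2 (kmul d (- m11%:~R / q%:~R, m%:~R / q%:~R) z).
  move=> _ [k [l ->]]; exists (l * a), (k * b - l * c).
  have -> : kmul d (- m11%:~R / q%:~R, m%:~R / q%:~R) (kadd (kzscale k e1) (kzscale l e2)) =
    kqscale (q%:~R)^-1 (kadd (kadd (kzscale k (kmul d (0, m%:~R) e1))
       (kzscale l (kmul d (0, m%:~R) e2)))
       (kzscale (- m11) (kadd (kzscale k e1) (kzscale l e2)))).
    by apply: K_ext; rewrite /kmul /kadd /kqscale /kzscale /=; ring.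
  have m22E : m22 = m11 - c * q by rewrite -cE; ring.
  by rewrite A B aE bE m22E; kfield.
have : (q %| 1)%Z.
  apply/dvdzP; exists n; apply: (@intr_inj rat); apply: (mulfI m0).
  have -> : m%:~R * (n * q)%:~R = (0 + m%:~R * n%:~R) * q%:~R :> rat by ring.
  by rewrite -nE mulr1 divfK.
by rewrite dvdz1 /=; have := prime_gt1 qp; lia.
Qed.

End OmegaMatrix.

(** Conductors $k$ and $l$ of one lattice divide each other: $lw$ stabilises it, hence lies in
    $\mathbb{Z} + kO_K$. *)
Lemma has_conductor_inj d L m m' :
  has_conductor d L m -> has_conductor d L m' -> m = m'.
Proof.
have dv k l : has_conductor d L k -> has_conductor d L l -> (k %| l)%N.
  move=> [k0 hk] [l0 hl].
  have /hk[a [_ [[b [c ->]] [_ E]]]] :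
      forall z, L z -> L (kmul d (0, l%:~R) z).
    apply/hl; exists 0, (0, 1); split; first by exists 0, 1.
    by rewrite /kadd /kzscale /=; congr pair; ring.
  suff : (k %| Posz l)%Z by [].
  by apply/dvdzP; exists c; apply: (@intr_inj rat); rewrite E rmorphM /=; ring.
by move=> hm hm'; apply/eqP; rewrite eqn_dvd !dv.
Qed.

Lemma Euclid_dvdzM p (x y : int) : prime p ->
  (p %| x * y)%Z = (p %| x)%Z || (p %| y)%Z.
Proof. by move=> hp; rewrite !dvdzE abszM /= Euclid_dvdM. Qed.

Lemma dvdz_sum_prod p (x y : int) : prime p ->
  (p %| x + y)%Z -> (p %| x * y)%Z -> (p %| x)%Z /\ (p %| y)%Z.
Proof.
move=> hp hs; rewrite Euclid_dvdzM // => /orP[] h.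
  by split=> //; move: hs; rewrite rpredDl.
by split=> //; move: hs; rewrite rpredDr.
Qed.

(* Such a matrix would make (w - m11) / p an endomorphism of a lattice, hence
   integral, although Z[w] is the maximal order; concretely the discriminant of w
   would be p^2 times a discriminant. *)
Lemma squarefree_maximal d p (m11 m12 m21 m22 : int) : squarefree d -> prime p ->
  m11 + m22 = Posz (tw d) -> m11 * m22 - m12 * m21 = Posz (nw d) ->
  (Posz p * Posz p %| m21)%Z -> (p %| m11 - m22)%Z -> False.
Proof.
move=> sf hp ht hn /dvdzP[r rE] /dvdzP[del dE].
(* The discriminant is $t^2 - 4n = (m_{11}-m_{22})^2 + 4m_{12}m_{21}$. *)
have disc : Posz (tw d) * Posz (tw d) - 4 * Posz (nw d) =
    (del * del + 4 * m12 * r) * (Posz p * Posz p).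
  rewrite -ht -hn rE; have -> : m11 = m22 + del * Posz p by rewrite -dE; ring.
  by ring.
have p2d : ~~ (Posz (p * p) %| Posz d)%Z by apply: sf; exact: prime_gt1.
move: disc; rewrite /tw /nw; case: ifP => [/eqP d3 disc|d3 disc].
  case/negP: p2d; apply/dvdzP; exists (- (del * del + 4 * m12 * r)).
  by rewrite PoszM mulNr -disc; lia.
(* Now $p^2 \mid 4d$, so $p^2 \mid d$ for odd $p$. For $p = 2$, $-d$ is a square modulo 4: either $4
   \mid d$ or $d \equiv 3$ modulo 4, both excluded. *)
have [p2|p2] := eqVneq p 2%N; last first.
  case/negP: p2d; rewrite -(@Gauss_dvdzr _ 4).
    by apply/dvdzP; exists (- (del * del + 4 * m12 * r)); rewrite PoszM mulNr -disc; lia.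
  have c2 : coprime p 2 by rewrite prime_coprime // dvdn_prime2.
  have c4 : coprime p 4 by exact: (@coprimeXr 2 p 2 c2).
  by rewrite coprimezE /= coprimeMl c4.
have := sf 2%N isT; have dE' : Posz d = - (del * del + 4 * m12 * r).
  by move: disc; rewrite p2; lia.
have [e [de|de]] : exists e, del = 2 * e \/ del = 2 * e + 1.
  by exists (divz del 2); lia.
  have : Posz d = 4 * (- (e * e + m12 * r)) by rewrite dE' de; ring.
  by move: (- _) => t; lia.
have : Posz d = 4 * (- (e * e + e + m12 * r)) - 1 by rewrite dE' de; ring.
by move: (- _) d3 => t; lia.
Qed.

(** * Change of the conductor along a step of index p *)

Section Superlattice.
Variables (d p : nat) (hp : prime p) (sf : squarefree d).

Let p0 : p%:~R != 0 :> rat.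
Proof. by rewrite intr_eq0; have := prime_gt0 hp; lia. Qed.

(** The condition $p \mid m_{21}$ says that $e_1$ spans an eigenline modulo $p$. The new matrix is
    written in the basis $e_1/p, e_2$; for [j = 0] the truncated [j.-1] leaves the conductor at
    1. *)
Lemma has_conductor_superlat j e1 e2 m11 m12 m21 m22 :
  kdet e1 e2 != 0 -> omega_mx d (p ^ j) e1 e2 m11 m12 m21 m22 ->
  primitive m12 m21 (m11 - m22) ->
  has_conductor d (superlat p e1 e2) (p ^ (if (p %| m21)%Z then j.-1 else j.+1)).
Proof.
move=> D mx pr; have [tr dt] := omega_mx_char D mx.
have D' := kdet_superlat hp D.
have pj n : (0 < p ^ n)%N by rewrite expn_gt0 prime_gt0.
have [A B] := mx.
apply/(has_conductorP _ (pj _) D'); case: ifP => [pm21|pm21]; last first.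
  exists (Posz p * m11), (Posz p * Posz p * m12), m21, (Posz p * m22); split.
    split.
      transitivity (kmul d (0, (p ^ j)%N%:~R) e1); last by rewrite A; kfield.
      by rewrite expnS; apply: K_ext; rewrite /kmul /kqscale /=; field.
    transitivity (kzscale p (kmul d (0, (p ^ j)%N%:~R) e2)); last by rewrite B; kfield.
    by rewrite expnS; apply: K_ext; rewrite /kmul /kzscale /=; ring.
  move=> q hq h12 h21 hd.
  have qp : (q %| Posz p)%Z = false.
    by rewrite dvdzE /= dvdn_prime2 //; apply/eqP => E; move: h21; rewrite E pm21.
  move: h12 hd; rewrite -mulrBr !Euclid_dvdzM // qp /= => ? ?; exact: (pr q).
have /dvdzP[r rE] := pm21.
case: j => [|j] /= in mx A B tr dt *.
  exists m11, (Posz p * m12), r, m22; split.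
    split; last by rewrite B; kfield.
    transitivity (kqscale (p%:~R)^-1 (kmul d (0, (p ^ 0)%N%:~R) e1)).
      by apply: K_ext; rewrite /kmul /kqscale /=; ring.
    by rewrite A rE; kfield.
  move=> q hq h12 h21 hd; have [qp|qp] := eqVneq q p.
    rewrite qp in h21 hd.
    (* Imprimitivity at $p$ would give $p^2 \mid m_{21}$ and $p \mid m_{11}-m_{22}$, against the
       maximality of $\mathbb{Z}[w]$. *)
    apply: (squarefree_maximal sf hp _ _ _ hd (m12 := m12) (m21 := m21)).
    - by rewrite tr mul1r.
    - by rewrite dt !mul1n.
    - by rewrite rE mulrC; apply: dvdz_mul.
  apply: (pr q hq) hd; last by rewrite rE dvdz_mulr.
  by move: h12; rewrite Euclid_dvdzM // dvdzE /= dvdn_prime2 // (negPf qp).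
(* The trace and the product of the diagonal entries are divisible by $p$, hence so is each of them;
   primitivity then makes $m_{12}$ prime to $p$. *)
have [p11 p22] : (p %| m11)%Z /\ (p %| m22)%Z.
  apply: dvdz_sum_prod => //; first by rewrite tr expnS PoszM -mulrA dvdz_mulr.
  have -> : m11 * m22 = Posz (p ^ j.+1 * p ^ j.+1 * nw d) + m12 * m21 by rewrite -dt; ring.
  by rewrite rpredD //; [rewrite expnS -!mulnA PoszM dvdz_mulr|rewrite dvdz_mull].
have p12 : ~~ (p %| m12)%Z.
  by apply/negP => p12; apply: (pr p hp) => //; rewrite rpredB.
have /dvdzP[n11 E11] := p11; have /dvdzP[n22 E22] := p22.
(* As $p^2$ divides the determinant and $m_{11}m_{22}$, it divides $m_{12}m_{21}$, hence $m_{21}$;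
   so the conductor can drop by a factor $p$. *)
have /dvdzP[r' rE'] : (p %| r)%Z.
  suff : (p %| m12 * r)%Z by rewrite Euclid_dvdzM // (negPf p12).
  apply/dvdzP; exists (n11 * n22 - Posz (p ^ j * p ^ j * nw d)).
  have pp0 : Posz p != 0 by have := prime_gt0 hp; lia.
  apply: (mulIf pp0).
  transitivity (m11 * m22 - Posz (p ^ j.+1 * p ^ j.+1 * nw d)).
    by rewrite -dt rE; ring.
  by rewrite E11 E22 expnS; ring.
exists n11, m12, r', n22; split.
  split.
    transitivity (kqscale (p%:~R)^-1 (kqscale (p%:~R)^-1 (kmul d (0, (p ^ j.+1)%N%:~R) e1))).
      by rewrite expnS; apply: K_ext; rewrite /kmul /kqscale /=; field.
    by rewrite A rE rE' E11; kfield.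
  transitivity (kqscale (p%:~R)^-1 (kmul d (0, (p ^ j.+1)%N%:~R) e2)).
    by rewrite expnS; apply: K_ext; rewrite /kmul /kqscale /=; field.
  by rewrite B E22; kfield.
move=> q hq h12 h21 hd; apply: (pr q hq) => //.
  by rewrite rE rE' -mulrA dvdz_mulr.
by rewrite E11 E22 -mulrBl dvdz_mulr.
Qed.

(** The lower left entry in the basis of direction [i]: the form $m_{21}X^2 + (m_{22}-m_{11})XY -
    m_{12}Y^2$ at $(k,1)$ or $(1,0)$, zero modulo $p$ exactly on eigenlines. *)
Definition dir_m21 (m11 m12 m21 m22 : int) (i : option 'F_p) : int :=
  if i is Some k then
    let z := Posz (k : nat) in z * z * m21 + z * m22 - z * m11 - m12
  else m21.

(** Primitivity survives the unimodular change of basis because the old entries $m_{12}$, $m_{21}$,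
    $m_{11}-m_{22}$ are integral combinations of the new ones. *)
Lemma omega_mx_dirb m e1 e2 m11 m12 m21 m22 i :
  omega_mx d m e1 e2 m11 m12 m21 m22 -> primitive m12 m21 (m11 - m22) ->
  exists n11 n12 n22,
    omega_mx d m (dirb e1 e2 i).1 (dirb e1 e2 i).2 n11 n12 (dir_m21 m11 m12 m21 m22 i) n22 /\
    primitive n12 (dir_m21 m11 m12 m21 m22 i) (n11 - n22).
Proof.
move=> [A B] pr; case: i => [k|]; last by exists m11, m12, m22.
rewrite /=; move: (Posz (k : nat)) => {}k.
exists (k * m21 + m22), (- m21), (m11 - k * m21); split.
  split.
    transitivity (kadd (kzscale k (kmul d (0, m%:~R) e1)) (kmul d (0, m%:~R) e2)).
      by apply: K_ext; rewrite /kmul /kadd /kzscale /=; ring.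
    by rewrite A B; kring.
  transitivity (kzscale (-1) (kmul d (0, m%:~R) e1)).
    by apply: K_ext; rewrite /kmul /kzscale /=; ring.
  by rewrite A; kring.
move=> q hq; rewrite dvdzE abszN -dvdzE => h21 h h3.
have hd : (q %| m11 - m22)%Z.
  have -> : m11 - m22 = 2 * k * m21 - (k * m21 + m22 - (m11 - k * m21)) by ring.
  by rewrite rpredB // dvdz_mull.
apply: (pr q hq) => //.
have -> : m12 = k * k * m21 - k * (m11 - m22) -
  (k * k * m21 + k * m22 - k * m11 - m12) by ring.
by rewrite rpredB // rpredB // dvdz_mull.
Qed.

End Superlattice.

(* [Some k] stands for the line through (k, 1) and [None] for the line through (1, 0); a
   non-scalar matrix has exactly one eigenline for each eigenvalue. *)
Lemma card_eigenlines (F : finFieldType) (m11 m12 m21 m22 : F) :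
  ~~ [&& m12 == 0, m21 == 0 & m11 == m22] ->
  #|[set i : option F | (if i is Some k then k * k * m21 + k * m22 - k * m11 - m12
                         else m21) == 0]| =
  #|[set l : F | l * l - (m11 + m22) * l + (m11 * m22 - m12 * m21) == 0]|.
Proof.
(* [h] sends an eigenline to its eigenvalue. *)
move=> ns; pose h (i : option F) := if i is Some k then m21 * k + m22 else m11.
set A := [set i | _].
have m12E k : Some k \in A -> m12 = k * k * m21 + k * m22 - k * m11.
  by rewrite inE subr_eq0 => /eqP.
have hinj : {in A &, injective h}.
  have aux k : Some k \in A -> None \in A -> m22 = m11 -> False.
    move=> /m12E kE; rewrite inE => /eqP m210 m2211.
    by case/negP: ns; apply/and3P; split; apply/eqP; rewrite ?kE ?m210 ?m2211 //; ring.
  case=> [k|] [l|] //= kA lA.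
  - move=> /addIr E; congr Some; have := m12E _ kA; rewrite (m12E _ lA) => E'.
    have [m210|m210] := eqVneq m21 0; last exact: (mulfI m210).
    have [e|ne] := eqVneq m22 m11.
      by exfalso; apply: (aux k) => //; rewrite inE m210.
    have ne' : m22 - m11 != 0 by rewrite subr_eq0.
    apply: (mulIf ne'); move: E'; rewrite m210 => E'.
    transitivity (k * k * 0 + k * m22 - k * m11); first by ring.
    by rewrite -E'; ring.
  - move=> E; exfalso; apply: (aux k) => //.
    by move: lA E; rewrite inE => /eqP ->; rewrite mul0r add0r.
  - move=> E; exfalso; apply: (aux l) => //.
    by move: kA E; rewrite inE => /eqP ->; rewrite mul0r add0r.
rewrite -(card_in_imset hinj); apply: eq_card => l; rewrite !inE.
apply/imsetP/eqP => [[[k|] kA ->]|E] /=.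
- by rewrite (m12E _ kA); ring.
- by move: kA; rewrite inE => /eqP ->; ring.
(* Each root comes from an eigenline: if $m_{21} \neq 0$, solve $m_{21}k + m_{22} = l$; otherwise
   the roots are $m_{11}$, for [None], and $m_{22}$. *)
have [m210|m210] := eqVneq m21 0; last first.
  exists (Some ((l - m22) / m21)) => /=; last by field.
  by rewrite inE; apply/eqP; apply: (mulfI m210); rewrite mulr0 -E; field.
have {}E : (l - m11) * (l - m22) = 0 by rewrite -E m210; ring.
have [e|ne] := eqVneq l m11; first by exists None; rewrite // inE m210.
have e : l = m22.
  by move/eqP: E; rewrite mulf_eq0 !subr_eq0 (negPf ne) => /eqP.
have ne' : m22 - m11 != 0 by rewrite subr_eq0 -e.
exists (Some (m12 / (m22 - m11))); rewrite /= ?inE m210 ?e; last by ring.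
by apply/eqP; field.
Qed.

Lemma card_nroots d p : prime p ->
  #|[set l : 'F_p | l * l - (tw d)%:R * l + (nw d)%:R == 0]| = nroots d p.
Proof.
move=> hp; pose h (x : 'I_p) : 'F_p := (x : nat)%:R.
have hinj : injective h.
  move=> x y /(congr1 val) /=; rewrite !val_Fp_nat // !modn_small //; exact: val_inj.
rewrite /nroots -(card_imset _ hinj); apply: eq_card => l; rewrite !inE.
have lp : (l < p)%N by have := ltn_ord l; rewrite [X in (_ < X)%N -> _]Fp_cast.
have lE : h (Ordinal lp) = l by exact: natr_Zp.
have cond (x : 'I_p) : ((x * x + nw d) %% p == (tw d * x) %% p)%N =
    (h x * h x - (tw d)%:R * h x + (nw d)%:R == 0).
  rewrite addrAC subr_eq0 /h -!natrM -natrD.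
  by rewrite -(inj_eq val_inj) /= !val_Fp_nat.
apply/idP/imsetP => [E|[x]]; last by rewrite inE cond => E ->.
by exists (Ordinal lp); rewrite // inE cond lE.
Qed.

(** * Levels of lattices and their neighbours *)

Section LatticeLevels.
Variables (d p : nat) (hp : prime p) (sf : squarefree d).

Definition lattice_level (L : K -> Prop) (j : nat) : Prop :=
  is_lattice L /\ has_conductor d L (p ^ j).

Lemma lattice_level_inj L i j : lattice_level L i -> lattice_level L j -> i = j.
Proof.
move=> [_ hi] [_ hj]; have := has_conductor_inj hi hj.
by move=> /eqP; rewrite eqn_exp2l ?prime_gt1 // => /eqP.
Qed.

(** [E] is the set of eigenlines, counted by the roots of $X^2 - p^j tX + p^{2j}n$ modulo $p$. For
    $j > 0$ this is $X^2$, with the single root 0. *)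
Lemma lattice_level_superdir L j : lattice_level L j ->
  exists e1 e2 (E : {set option 'F_p}),
    [/\ kdet e1 e2 != 0, L = zspan e1 e2,
        forall i, lattice_level (superdir e1 e2 i) (if i \in E then j.-1 else j.+1) &
        #|E| = if j == 0%N then nroots d p else 1%N].
Proof.
move=> [/is_latticeP[e1 [e2 [D ->]]]].
have pj : (0 < p ^ j)%N by rewrite expn_gt0 prime_gt0.
move=> /(has_conductorP _ pj D)[m11 [m12 [m21 [m22 [mx pr]]]]].
exists e1, e2, [set i | (p %| dir_m21 m11 m12 m21 m22 i)%Z]; split=> //.
  move=> i; have [n11 [n12 [n22 [nx npr]]]] := omega_mx_dirb i mx pr.
  have D' : kdet (dirb e1 e2 i).1 (dirb e1 e2 i).2 != 0 by rewrite kdet_dirb.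
  split; last by rewrite inE; exact: (has_conductor_superlat hp sf D' nx npr).
  apply/is_latticeP; exists (kqscale (p%:~R)^-1 (dirb e1 e2 i).1), (dirb e1 e2 i).2.
  by split=> //; exact: kdet_superlat.
have [tr dt] := omega_mx_char D mx.
have := @card_eigenlines 'F_p m11%:~R m12%:~R m21%:~R m22%:~R.
have -> : [set i : option 'F_p |
     (if i is Some k then k * k * m21%:~R + k * m22%:~R - k * m11%:~R - m12%:~R
      else m21%:~R) == 0] = [set i | (p %| dir_m21 m11 m12 m21 m22 i)%Z].
  apply/setP => i; rewrite !inE -Fp_int_eq0 //; case: i => [k|] //=.
  by rewrite !(rmorphB, rmorphD, rmorphM) /= !Fp_int_repr.
move=> ->; last first.
  apply/negP; rewrite !Fp_int_eq0 // -subr_eq0 -rmorphB /= Fp_int_eq0 //.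
  by move=> /and3P[]; exact: pr.
have -> : m11%:~R + m22%:~R = (Posz (p ^ j) * Posz (tw d))%:~R :> 'F_p by rewrite -tr rmorphD.
have -> : m11%:~R * m22%:~R - m12%:~R * m21%:~R = (p ^ j * p ^ j * nw d)%N%:~R :> 'F_p.
  by rewrite -dt rmorphB !rmorphM.
case: eqP => [->|/eqP j0].
  by rewrite expn0 mul1r !mul1n -[RHS](card_nroots d hp).
have -> : (Posz (p ^ j) * Posz (tw d))%:~R = 0 :> 'F_p.
  by apply/eqP; rewrite Fp_int_eq0 // dvdz_mulr // dvdzE /= dvdn_exp ?lt0n.
have -> : (p ^ j * p ^ j * nw d)%N%:~R = 0 :> 'F_p.
  by apply/eqP; rewrite Fp_int_eq0 // dvdzE /= -mulnA dvdn_mulr // dvdn_exp ?lt0n.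
rewrite -[RHS](cards1 (0 : 'F_p)); apply: eq_card => l.
by rewrite !inE mul0r subr0 addr0 mulf_eq0 orbb.
Qed.

Lemma lattice_level_adj L L' j : lattice_level L j -> cyclic_quotient L L' p ->
  exists2 l, (l < j.+2)%N & lattice_level L' l.
Proof.
move=> /lattice_level_superdir[e1 [e2 [E [D -> lv _]]]] /(superdirP hp _ D)[i <-].
by exists (if i \in E then j.-1 else j.+1); [case: ifP; lia|exact: lv].
Qed.

Lemma lattice_level_shrink L j : lattice_level L j -> lattice_level (shrink p L) j.
Proof.
have p0 : p%:~R != 0 :> rat by rewrite intr_eq0; have := prime_gt0 hp; lia.
have pj : (0 < p ^ j)%N by rewrite expn_gt0 prime_gt0.
move=> [/is_latticeP[e1 [e2 [D ->]]] /(has_conductorP _ pj D) mx].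
rewrite (shrink_zspan hp).
have D' : kdet (kqscale (p%:~R)^-1 e1) (kqscale (p%:~R)^-1 e2) != 0.
  have -> : kdet (kqscale (p%:~R)^-1 e1) (kqscale (p%:~R)^-1 e2) =
      (p%:~R)^-1 * (p%:~R)^-1 * kdet e1 e2 by rewrite /kdet /kqscale /=; ring.
  by rewrite !mulf_neq0 ?invr_eq0.
split; first by apply/is_latticeP; do 2 eexists; split; first exact: D'.
apply/(has_conductorP _ pj D').
have [m11 [m12 [m21 [m22 [[A B] pr]]]]] := mx.
exists m11, m12, m21, m22; split=> //.
have com u : kmul d (0, (p ^ j)%N%:~R) (kqscale (p%:~R)^-1 u) =
    kqscale (p%:~R)^-1 (kmul d (0, (p ^ j)%N%:~R) u).
  by apply: K_ext; rewrite /kmul /kqscale /=; ring.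
by split; rewrite com ?A ?B; kring.
Qed.

(** The $p+1$ directions split into [E] and its complement, whose sizes are the degrees of the
    volcano. *)
Lemma ncard_lattice_adj L j l : lattice_level L j ->
  ncard (fun L' => cyclic_quotient L L' p /\ lattice_level L' l) (volcano_degree d p j l).
Proof.
move=> /lattice_level_superdir[e1 [e2 [E [D -> lv cE]]]].
have cT : #|[set: option 'F_p]| = p.+1 by rewrite cardsT card_option card_Fp.
have cEC : #|~: E| = (p.+1 - #|E|)%N by rewrite -cT -cardsDS ?subsetT // setTD.
have <- : #|[set i | (if i \in E then j.-1 else j.+1) == l]| = volcano_degree d p j l.
  rewrite /volcano_degree; case: j => [|j] /= in lv cE *.
    case: eqP => [->|/eqP l0].
      by rewrite -cE; apply: eq_card => i; rewrite inE; case: ifP.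
    case: eqP => [->|/eqP l1].
      by rewrite -cE -cEC; apply: eq_card => i; rewrite !inE; case: ifP.
    by apply: eq_card0 => i; rewrite !inE; case: ifP => _; rewrite eq_sym; apply/negbTE.
  case: eqP => [->|/eqP l0].
    by rewrite -cE; apply: eq_card => i; rewrite inE; case: ifP; lia.
  case: eqP => [->|/eqP l1].
    rewrite -[RHS](subn1 p.+1) -cE -cEC; apply: eq_card => i; rewrite !inE.
    by case: ifP; lia.
  by apply: eq_card0 => i; rewrite !inE; case: ifP => _; rewrite eq_sym; apply/negbTE.
apply: (@ncard_set _ _ _ (superdir e1 e2)).
  by move=> i i' _ _; exact: superdir_inj.
move=> L'; split=> [[/(superdirP hp _ D)[i <-] lvi]|[i]].
  by exists i; rewrite // inE (lattice_level_inj (lv i) lvi).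
by rewrite inE => /eqP <- <-; split; [apply/superdirP => //; exists i|exact: lv].
Qed.

End LatticeLevels.

Local Close Scope ring_scope.

(** * Comparison of the two counts *)

Theorem theorem4p3 (d : nat) (hd0 : (0 < d)%N) (hd : squarefree d)
  (p : nat) (hp : prime p) (a b c : nat)
  (Lam : K -> Prop) (hLam : is_lattice Lam) (hcond : has_conductor d Lam (p ^ a))
  (V : Type) (adj : V -> V -> Prop) (level : V -> nat)
  (hG : is_volcano d p adj level) (v0 : V) (hv0 : level v0 = a) :
  exists n : nat,
    rK_is d Lam (p ^ c) (p ^ b) n /\
    ncard (fun s : seq V => nb_walk adj v0 c s /\ level (last v0 s) = b) n.
Proof.
exists (nb_count (volcano_degree d p) c a None b); split; last exact: ncard_volcano_walk.
have walks := @ncard_nbwalk _ (fun L L' => cyclic_quotient L L' p) (shrink p)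
  (lattice_level d p) (volcano_degree d p) (lattice_level_inj hp)
  (lattice_level_adj hp hd) (lattice_level_shrink hp)
  (fun L L' j lv => cyclic_quotient_shrink hp lv.1) (ncard_lattice_adj hp hd)
  Lam a c b (conj hLam hcond).
apply: (ncard_cyclic_quotient (Q := fun L => has_conductor d L (p ^ b)) hp hLam).
(* [lattice_level] also asks for a lattice, which every term of such a walk is. *)
apply: ncard_ext walks => s; split=> [[hs [_ hb]]|[hs hb]] //; split=> //; split=> //.
have [slat _] := nbwalk_chain hp hLam hs; have [ss _] := hs.
by rewrite (last_nth Lam) ss; exact: slat.
Qed.
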